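(* Let $r\ge1$, $n=2r$, and let $\lambda=(\lambda_1,\lambda_2,2^{m_2},1^{m_1})$ be a partition of $n$ with $\lambda_2\ge2$ (so $\lambda$ has at most two parts larger than $2$ and is not a hook), where $m_2,m_1\ge0$ are the numbers of parts equal to $2$, resp. $1$, after the second part. Then $$g_{(r,r)\lambda}=\sum_{i=1}^{r-1}(-1)^{i+r+1}\big(N^{(n-i-\lambda_1)}(\lambda)-N^{(i-\lambda_1)}(\lambda)\big),$$ and consequently $$g_{(r,r)\lambda}=\begin{cases}1 & \text{if } \lambda_2+m_1-1\le\lambda_1\le\lambda_2+m_1+1,\\ 0 & \text{otherwise.}\end{cases}$$
   Context: $P_\mu(x;t)$ is the Hall–Littlewood $P$-function, well defined at $t=-1$ for all partitions $\mu$; $g_{\mu\lambda}$ are defined by $P_\mu(x;-1)=\sum_\lambda g_{\mu\lambda}s_\lambda(x)$ with $s_\lambda$ the Schur functions. $(r,r)$ is the partition with two parts equal to $r$. For a partition $\lambda$, $\lambda^{[1]}=(\lambda_2,\lambda_3,\dots)$; a hook is a nonempty partition $(a,1^b)$, $a\ge1,b\ge0$; $N^{(s)}(\lambda)$ is the number of hooks $\rho\subseteq\lambda^{[1]}$ such that $\lambda^{[1]}/\rho$ is a vertical $s$-strip ($|\lambda^{[1]}|-|\rho|=s$ and at most one box in each row); it is $0$ for $s<0$. *)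

(* Defs.v *)
From mathcomp Require Import all_boot all_order all_algebra.
From mathcomp Require Import fraction mpoly.
From mathcomp Require Import zify.

Set Implicit Arguments.
Unset Strict Implicit.
Unset Printing Implicit Defensive.

Import GRing.Theory.
Local Open Scope ring_scope.

Definition is_partition (la : seq nat) : bool :=
  sorted geq la && (0%N \notin la).

(** All partitions of [n], each listed once (see [mem_partitions] and
    [partitions_uniq]).  A partition of [n] has at most [n] parts, each at most
    [n], so it is obtained by dropping the zeros of an [n]-tuple over
    [{0, ..., n}]. *)
Definition partitions (n : nat) : seq (seq nat) :=
  undup [seq la <- [seq [seq k <- map val (tval t) | k != 0%N]
                   | t : n.-tuple 'I_n.+1]
        | is_partition la && (sumn la == n)].

Lemma partitions_uniq n : uniq (partitions n).
Proof. exact: undup_uniq. Qed.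

Lemma mem_partitions n la :
  (la \in partitions n) = is_partition la && (sumn la == n).
Proof.
rewrite mem_undup mem_filter; apply: andb_idr => /andP [/andP [_ la0] /eqP sla].
have size_la : (size la <= n)%N.
  rewrite -sla; elim: la la0 {sla} => //= k la IH.
  rewrite inE negb_or => /andP [k0 /IH]; lia.
have bound : all (fun k => k < n.+1)%N la.
  rewrite -sla; apply/allP; elim: la {la0 sla size_la} => //= k la IH j.
  rewrite inE => /orP [/eqP -> | /IH]; lia.
have : exists t : n.-tuple 'I_n.+1,
    map val (tval t) = la ++ nseq (n - size la) 0%N.
  have sz : size [seq inord k : 'I_n.+1 | k <- la ++ nseq (n - size la) 0%N] == n.
    by rewrite size_map size_cat size_nseq subnKC.
  exists (Tuple sz); rewrite /= -map_comp -[RHS]map_id; apply/eq_in_map => k.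
  rewrite mem_cat => /orP [/(allP bound) | ] ; first by move=> hk; exact: inordK.
  by rewrite mem_nseq => /andP [_ /eqP ->]; exact: inordK.
case=> t tE; apply/mapP; exists t; first by rewrite mem_enum.
rewrite /= tE filter_cat (_ : filter _ (nseq _ _) = [::]) ?cats0.
  by apply/esym/all_filterP/allP => k hk; apply: contraNneq la0 => <-.
by apply/eqP; rewrite -size_eq0 size_filter count_nseq.
Qed.

(** Schur and Hall-Littlewood polynomials in [N] variables are given by the
    usual quotients, read in the field of fractions of [R[x_0, ..., x_(N-1)]]. *)

Section SymmetricPolynomials.
Context (R : idomainType) (N : nat).

Definition xvar (i : 'I_N) : {fraction {mpoly R[N]}} := tofrac 'X_i.

Definition cst (c : R) : {fraction {mpoly R[N]}} := tofrac (c%:MP_[N]).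

(** [a_(la + delta) / a_delta], and [0] if [la] has more than [N] parts. *)
Definition schur (la : seq nat) : {fraction {mpoly R[N]}} :=
  if (size la <= N)%N then
    \det (\matrix_(i < N, j < N) xvar j ^+ (nth 0%N la i + (N - i.+1)))
    / \det (\matrix_(i < N, j < N) xvar j ^+ (N - i.+1))
  else 0.

(** The Hall-Littlewood polynomial [P_mu(x_1, ..., x_N; t)]: the sum over
    [w] in [S_N / S_N^mu], where [S_N^mu] is the stabiliser of [mu], of
    [w (x^mu \prod_(mu_i > mu_j) (x_i - t x_j) / (x_i - x_j))]; it is [0] if
    [mu] has more than [N] parts.  A coset of [S_N^mu] amounts to a
    rearrangement [a = w mu] of [mu] (padded with zeros), and the
    corresponding term is [x^a \prod_(a_i > a_j) (x_i - t x_j) / (x_i - x_j)].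
    Unlike the sum over [S_N] divided by [v_mu(t)], this has no denominator
    depending on [t], so that [t] may be any scalar, including [-1]. *)
Definition hall_littlewood_P (t : R) (mu : seq nat) : {fraction {mpoly R[N]}} :=
  if (size mu <= N)%N then
    \sum_(a <- permutations (mu ++ nseq (N - size mu) 0%N))
      (\prod_(i < N) xvar i ^+ nth 0%N a i) *
      \prod_(i < N) \prod_(j < N | (nth 0%N a j < nth 0%N a i)%N)
        ((xvar i - cst t * xvar j) / (xvar i - xvar j))
  else 0.

End SymmetricPolynomials.

(** [P_mu(x; -1) = \sum_la g la *: s_la(x)] in the ring of symmetric functions
    in infinitely many variables, i.e., in [N] variables for every [N].  By
    homogeneity, only the partitions of [|mu|] contribute. *)
Definition hall_littlewood_schur_coeffs
    (mu : seq nat) (g : seq nat -> int) : Prop :=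
  forall N : nat,
    hall_littlewood_P N (-1 : int) mu =
    \sum_(la <- partitions (sumn mu)) cst N (g la) * schur int N la.

Definition hook (a b : nat) : seq nat := a :: nseq b 1%N.

Definition included (rho la : seq nat) : bool :=
  all (fun i => nth 0%N rho i <= nth 0%N la i)%N (iota 0 (size rho)).

Definition vertical_strip (s : int) (rho la : seq nat) : bool :=
  [&& included rho la,
      all (fun i => nth 0%N la i - nth 0%N rho i <= 1)%N (iota 0 (size la))
    & (sumn la)%:Z - (sumn rho)%:Z == s].

(** The number of hooks [(a, 1^b)], [a >= 1], [b >= 0], contained in
    [la^[1] = behead la] and such that [la^[1] / (a, 1^b)] is a vertical
    [s]-strip.  Containment forces [a] and [b] to be at most [|la^[1]|], and
    [s] to be nonnegative. *)
Definition Nhook (s : int) (la : seq nat) : nat :=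
  let la1 := behead la in
  #|[set ab : 'I_(sumn la1).+1 * 'I_(sumn la1).+1 |
      (0 < ab.1)%N && vertical_strip s (hook ab.1 ab.2) la1]|.

(* Main.v *)
Require Import Defs.
From mathcomp Require Import all_boot all_order all_algebra.
From mathcomp Require Import all_fingroup fraction mpoly zify ring.

Import GRing.Theory.
Local Open Scope ring_scope.

(** Work in [N = m2 + m1 + 2] variables and read off the coefficient of
    [x^(la + delta)] in [a_delta P_(r,r)(x; -1)].  By the Vandermonde formula,
    multiplying the term of a rearrangement [a] of [(r, r, 0, ..., 0)] by
    [a_delta] gives, up to sign, [x^a] times the Vandermonde determinant in
    which the variables [x_i] with [a_i > 0] are negated.  If [a_0] or [a_1]
    vanishes, the exponent of [x_0] or [x_1] is less than [N], too small since
    [la_2 >= 2].  So only [a = (r, r, 0, ..., 0)] contributes, and there a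
    single permutation matches the exponents; hence [g la] is [1] if
    [l1 = l2 + m1] and [0] otherwise.  As [l1 + l2 + m1] is even, this is the
    interval condition of the theorem.  On the other side, the hooks [(a, 1^b)]
    that count are those with [l2 - 1 <= a <= l2] and [m2 <= b <= m2 + m1], so
    the alternating sum telescopes. *)

(** * Hooks with vertical-strip complement and their alternating sum *)

Lemma nth_hook a b i :
  nth 0%N (hook a b) i = (if i == 0 then a else (i <= b) : nat)%N.
Proof. by case: i => [|i] //=; rewrite nth_nseq; case: ltnP. Qed.

Lemma nth_two_one m2 m1 i :
  nth 0%N (nseq m2 2%N ++ nseq m1 1%N) i = ((i < m2) + (i < m2 + m1))%N.
Proof.
rewrite nth_cat size_nseq !nth_nseq; case: ltnP => im2.
  by rewrite ltn_addr.
by rewrite ltn_subLR //; case: ifP.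
Qed.

(** A row of length 2 missed by the leg would lose two boxes, so the leg covers all [m2] of them,
    and containment stops it after [m2 + m1] rows; the first row may lose at most one box. *)
Lemma vertical_strip_hook s a b l2 m2 m1 :
  vertical_strip s (hook a b) (l2 :: nseq m2 2%N ++ nseq m1 1%N) =
  [&& (l2 - 1 <= a <= l2)%N, (m2 <= b <= m2 + m1)%N
    & (l2 + 2 * m2 + m1)%:Z - (a + b)%:Z == s].
Proof.
have -> : (l2 + 2 * m2 + m1 = sumn (l2 :: nseq m2 2%N ++ nseq m1 1%N))%N.
  by rewrite /= sumn_cat !sumn_nseq; lia.
have -> : (a + b = sumn (hook a b))%N by rewrite /= sumn_nseq; lia.
rewrite /vertical_strip andbA [RHS]andbA; congr (_ && _).
rewrite /included /=.
apply/idP/idP.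
  move=> /andP[/andP[al /allP inc] /andP[la1 /allP vert]].
  have bm : (b <= m2 + m1)%N.
    case: (posnP b) => [-> // | b0].
    have := inc b; rewrite mem_iota size_nseq nth_hook.
    by case: b b0 {inc vert} => // b _ /=; rewrite nth_two_one => /(_ _); lia.
  have mb : (m2 <= b)%N.
    rewrite leqNgt; apply/negP => bm2.
    have := vert b.+1.
    rewrite mem_iota size_cat !size_nseq /= nth_nseq ltnn nth_two_one => /(_ _); lia.
  lia.
move=> H; apply/andP; split; apply/andP; split; try lia.
  apply/allP => i; rewrite mem_iota size_nseq.
  by case: i => //= i; rewrite nth_nseq nth_two_one; case: ifP; lia.
apply/allP => i; rewrite mem_iota size_cat !size_nseq.
by case: i => //= i; rewrite nth_nseq nth_two_one; case: ifP; lia.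
Qed.

Lemma card_pred1_and (T : finType) (c : T) (b : bool) :
  #|[set x | (x == c) && b]| = b :> nat.
Proof.
case: b; first by rewrite -[RHS](cards1 c); apply: eq_card => x; rewrite !inE andbT.
by apply/eqP; rewrite cards_eq0; apply/eqP/setP => x; rewrite !inE andbF.
Qed.

(** The strip size forces [a + b = k], so each of the arms [a = l2] and [a = l2 - 1] admits at most
    one leg. The set [B] separates these two arms, which give [inb k] and [inb k.+1]. *)
Lemma Nhook_two_one l1 l2 m2 m1 k : (2 <= l2)%N ->
  let inb j := (l2 + m2 <= j <= l2 + m2 + m1)%N in
  Nhook ((l2 + 2 * m2 + m1)%:Z - k%:Z) [:: l1, l2 & nseq m2 2%N ++ nseq m1 1%N]
  = (inb k + inb k.+1)%N.
Proof.
move=> hl2 inb; rewrite /Nhook.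
set n1 := sumn _.
have n1E : n1 = (l2 + 2 * m2 + m1)%N.
  by rewrite /n1 /= sumn_cat !sumn_nseq; lia.
set A := [set _ | _].
pose B := [set ab : 'I_n1.+1 * 'I_n1.+1 | ab.1 == l2 :> nat].
rewrite -(cardsID B A); congr (_ + _)%N.
  rewrite -(@card_pred1_and _ (inord l2 : 'I_n1.+1, inord (k - l2) : 'I_n1.+1) (inb k)).
  apply: eq_card => -[a b]; rewrite !inE xpair_eqE -!val_eqE /=.
  rewrite vertical_strip_hook (inordK (_ : l2 < n1.+1)%N); last by lia.
  case Hk : (inb k); last by rewrite /inb in Hk; lia.
  by rewrite inordK; rewrite /inb in Hk *; lia.
rewrite -(@card_pred1_and _ (inord l2.-1 : 'I_n1.+1, inord (k.+1 - l2) : 'I_n1.+1) (inb k.+1)).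
apply: eq_card => -[a b]; rewrite !inE xpair_eqE -!val_eqE /=.
rewrite vertical_strip_hook (inordK (_ : l2.-1 < n1.+1)%N); last by lia.
case Hk : (inb k.+1); last by rewrite /inb in Hk; lia.
by rewrite inordK; rewrite /inb in Hk *; lia.
Qed.

Lemma sum_Nhook_two_one (r l1 l2 m2 m1 : nat)
  (la := [:: l1, l2 & nseq m2 2%N ++ nseq m1 1%N]) :
  (1 <= r)%N -> (2 <= l2)%N -> (l2 <= l1)%N ->
  (l1 + l2 + 2 * m2 + m1 = 2 * r)%N ->
  \sum_(1 <= i < r)
     (-1) ^+ (i + r + 1) *
     ((Nhook ((2 * r)%:Z - i%:Z - l1%:Z) la)%:Z - (Nhook (i%:Z - l1%:Z) la)%:Z)
  = (l1 == l2 + m1)%N%:Z.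
Proof.
move=> hr hl2 hl12 hn.
pose inb j := (l2 + m2 <= j <= l2 + m2 + m1)%N.
(* The two counts at [i] are [inb i + inb i.+1] and [inb (2r - i) + inb (2r - i + 1)]; with the
   alternating sign, the summand is [f i.+1 - f i]. *)
pose f i : int := (-1) ^+ (i + r + 1) * ((inb (2 * r - i).+1)%:Z - (inb i)%:Z).
rewrite (GRing.telescope_sumr_eq f) // => [|i /andP[i1 ir]].
  rewrite /f addnn -mul2n exprD exprM sqrrN !expr1n.
  have -> : inb (2 * r - 1).+1 = false by rewrite /inb; lia.
  have -> : inb 1%N = false by rewrite /inb; lia.
  have -> : (2 * r - r = r)%N by lia.
  rewrite subrr mulr0 subr0 mul1r expr1 mulN1r opprB.
  (* What remains is [inb r - inb r.+1]. Since [l2 <= l1] gives [l2 + m2 <= r], it is 1 exactly when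
     [r] is the upper bound [l2 + m2 + m1], and 0 otherwise. *)
  by rewrite /inb; case: eqP; lia.
have -> : (2 * r)%:Z - i%:Z - l1%:Z = (l2 + 2 * m2 + m1)%:Z - i%:Z by lia.
have -> : i%:Z - l1%:Z = (l2 + 2 * m2 + m1)%:Z - (2 * r - i)%N%:Z by lia.
rewrite !Nhook_two_one // -!/(inb _) /f.
have -> : (2 * r - i.+1).+1 = (2 * r - i)%N by lia.
rewrite !addSn exprS !PoszD; ring.
Qed.

(** * Vandermonde determinants with some variables negated *)

Lemma prod_ord_pairs (R : comPzRingType) N (g : 'I_N -> 'I_N -> R) :
  (forall i, g i i = 1) ->
  \prod_i \prod_j g i j = \prod_(i < N) \prod_(j < N | (i < j)%N) (g i j * g j i).
Proof.
move=> gii.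
under [RHS]eq_bigr do rewrite big_split.
rewrite big_split /= [X in _ * X](exchange_big_dep xpredT) //= -big_split.
apply: eq_bigr => i _; rewrite (bigID (fun j : 'I_N => (i < j)%N)) /=.
congr (_ * _); rewrite (bigD1 i) ?ltnn //= gii mul1r.
by apply: eq_bigl => j; rewrite -leqNgt ltn_neqAle andbC.
Qed.

Lemma det_rev_Vandermonde (R : comPzRingType) N (x : 'I_N -> R) :
  \det (\matrix_(i, j) x j ^+ (N - i.+1)) =
  (-1) ^+ perm (@rev_ord_inj N) *
    \prod_(i < N) \prod_(j < N | (i < j)%N) (x j - x i).
Proof.
transitivity (\det (row_perm (perm (@rev_ord_inj N)) (Vandermonde N (\row_j x j)))).
  by congr (\det _); apply/matrixP => i j; rewrite !mxE permE.
rewrite row_permE det_mulmx det_perm det_Vandermonde; congr (_ * _).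
by apply: eq_bigr => i _; apply: eq_bigr => j _; rewrite !mxE.
Qed.

Lemma det_rev_Vandermonde_neq0 (F : fieldType) N (x : 'I_N -> F) :
  injective x -> \det (\matrix_(i, j) x j ^+ (N - i.+1)) != 0.
Proof.
move=> injx; rewrite det_rev_Vandermonde mulf_neq0 ?signr_eq0 //.
apply/prodf_neq0 => i _; apply/prodf_neq0 => j ij.
by rewrite subr_eq0 (inj_eq injx) -val_eqE /=; lia.
Qed.

(** Checked pair by pair: for [i < j], if exactly one of the two variables is negated, the quotient
    turns [x j - x i] into [x i + x j] up to sign; if both are, the difference only changes sign.
    The factor [(-1) ^+ (p i || p j)] corrects the sign in each case. *)
Lemma det_rev_Vandermonde_signs (F : fieldType) N (x : 'I_N -> F)
    (p : pred 'I_N) :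
  injective x ->
  \det (\matrix_(i, j) x j ^+ (N - i.+1)) *
    \prod_i \prod_(j | ~~ p j && p i) ((x i + x j) / (x i - x j)) =
  (\prod_(i < N) \prod_(j < N | (i < j)%N) (-1) ^+ (p i || p j)) *
    \det (\matrix_(i, j) ((-1) ^+ p j * x j) ^+ (N - i.+1)).
Proof.
move=> injx; rewrite !det_rev_Vandermonde mulrCA -mulrA; congr (_ * _).
under [in LHS]eq_bigr do rewrite big_mkcond.
rewrite prod_ord_pairs => [|i]; last by rewrite andNb.
rewrite -!big_split; apply: eq_bigr => i _; rewrite -!big_split.
apply: eq_bigr => j ij /=.
have xij : x i - x j != 0.
  by rewrite subr_eq0 (inj_eq injx) -val_eqE /=; lia.
have xji : x j - x i != 0.
  by rewrite subr_eq0 (inj_eq injx) -val_eqE /=; lia.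
by case: (p i); case: (p j) => /=; field.
Qed.

(** * Monomial coefficients of generalized alternants *)

Lemma mcoeff_det_scale_expX N (c : 'I_N -> 'I_N -> int) (e : 'I_N -> 'I_N -> nat)
    (m : 'X_{1..N}) :
  (\det (\matrix_(i, j) (c i j *: 'X_j ^+ e i j)) : {mpoly int[N]})@_m =
  \sum_(s : 'S_N) (-1) ^+ s * (\prod_j c (s j) j) *
    [forall j, e (s j) j == m j]%:R.
Proof.
(* After transposing, [s j] is the row chosen in column [j], so each Leibniz term is one monomial
   indexed by its variables. *)
rewrite -det_tr raddf_sum; apply: eq_bigr => s _ /=.
under eq_bigr do rewrite !mxE.
rewrite scaler_prod -scalerAr mcoeffZ -[RHS]mulrA [RHS]mulrCA; congr (_ * _).
rewrite (_ : \prod_i _ = 'X_[[multinom e (s i) i | i < N]]).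
  rewrite !mulr_sign (fun_if (mcoeff m)) mcoeffN mcoeffX.
  suff -> : [forall j, e (s j) j == m j] = ([multinom e (s i) i | i < N] == m) by [].
 
  apply/forallP/eqP => [H|<- i]; last by rewrite mnmE.
  by apply/mnmP => i; rewrite mnmE; apply/eqP.
by rewrite mpolyXE_id; apply: eq_bigr => i _; rewrite mnmE.
Qed.

(** By induction an increasing permutation satisfies [k <= t k]; applying this to [s] and to its
    inverse gives equality. *)
Lemma homo_ltn_perm1 N (s : 'S_N) :
  {homo s : i j / (i < j)%N} -> s = 1%g.
Proof.
have le_id (t : 'S_N) (k : 'I_N) : {homo t : i j / (i < j)%N} -> (k <= t k)%N.
  move=> ht; case: k => k; elim: k => // k IH kN.
  have := ht (Ordinal (ltnW kN)) (Ordinal kN) (ltnSn k).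
  by have := IH (ltnW kN); rewrite /=; lia.
move=> hs; apply/permP => k; rewrite perm1; apply/val_inj/eqP.
rewrite eqn_leq le_id // andbT.
have /(le_id _ (s k)) : {homo s^-1%g : i j / (i < j)%N}; last by rewrite permK.
move=> i j; apply: contraTT; rewrite -!leqNgt leq_eqVlt => /orP[/eqP H|/hs].
  by rewrite (perm_inj (val_inj H)).
by rewrite !permKV; apply: ltnW.
Qed.

Lemma partition_nth_leq la i j : is_partition la -> (i <= j)%N ->
  (nth 0%N la j <= nth 0%N la i)%N.
Proof.
case/andP => sla _ ij.
case: (ltnP j (size la)) => jla; last by rewrite [leqLHS]nth_default.
have geq_trans : transitive geq by move=> a b c /= ab ca; apply: leq_trans ab.
apply: (sorted_leq_nth geq_trans leqnn 0%N sla i j) => //.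
by rewrite inE (leq_ltn_trans ij).
Qed.

(** Both [mu + delta] and [la + delta] strictly decrease, so a matching permutation is increasing,
    hence trivial. As [la] has exactly [N] nonzero parts, equality of the first [N] entries also
    rules out a shorter [mu]. *)
Lemma mcoeff_alternant N la mu :
  is_partition la -> size la = N -> is_partition mu -> (size mu <= N)%N ->
  (\det (\matrix_(i < N, j < N) 'X_j ^+ (nth 0%N mu i + (N - i.+1)))
     : {mpoly int[N]})@_[multinom (nth 0%N la i + (N - i.+1))%N | i < N] =
  (mu == la)%:R.
Proof.
move=> pla szla pmu szmu.
rewrite (_ : \matrix_(i, j) _ = \matrix_(i, j) (1 *: 'X_j ^+ (nth 0%N mu i + (N - i.+1)))); last first.
  by apply/matrixP => i j; rewrite !mxE scale1r.
rewrite mcoeff_det_scale_expX (bigD1 1%g) //= [X in _ + X]big1 => [|s s1].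
  rewrite addr0 odd_perm1 big1 // !mul1r; congr (nat_of_bool _)%:R.
  apply/forallP/eqP => [H|-> i]; last by rewrite mnmE perm1.
  have nthE i : (i < N)%N -> nth 0%N mu i = nth 0%N la i.
    by move=> iN; have := H (Ordinal iN); rewrite mnmE perm1 /=; lia.
  apply: (@eq_from_nth _ 0%N) => [|i imu]; last by apply: nthE; lia.
  apply/eqP; rewrite eqn_leq szla szmu leqNgt; apply/negP => lt.
  have := nthE _ lt; rewrite nth_default // => /esym H0.
  by case/andP: pla => _; rewrite -H0 mem_nth // szla.
case: forallP => H; last by rewrite mulr0.
case/negP: s1; apply/eqP; apply: homo_ltn_perm1 => i j ij.
rewrite ltnNge; apply/negP => ji.
have := H i; have := H j; rewrite !mnmE.
have := partition_nth_leq _ _ _ pla (ltnW ij).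
have := partition_nth_leq _ _ _ pmu ji.
have := ltn_ord j; have := ltn_ord (s i).
lia.
Qed.

(** * Clearing denominators in the Hall-Littlewood terms *)

Lemma xvar_inj (R : idomainType) N : injective (@xvar R N).
Proof.
move=> i j /eqP; rewrite /xvar tofrac_eq => /eqP /(congr1 (mcoeff U_(i))).
by rewrite !mcoeffXU eqxx; case: eqP => // _ /eqP; rewrite oner_eq0.
Qed.

Lemma alternant_hall_littlewood_term N r (a : seq nat)
    (p := fun i : 'I_N => (0 < nth 0%N a i)%N) :
  (forall i : 'I_N, nth 0%N a i \in [:: 0%N; r]) ->
  \det (\matrix_(i < N, j < N) xvar int j ^+ (N - i.+1)) *
    ((\prod_(i < N) xvar int i ^+ nth 0%N a i) *
     \prod_(i < N) \prod_(j < N | (nth 0%N a j < nth 0%N a i)%N)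
        ((xvar int i - cst N (-1 : int) * xvar int j) / (xvar int i - xvar int j))) =
  tofrac ((\prod_(i < N) \prod_(j < N | (i < j)%N) (-1) ^+ (p i || p j)) *:
    \det (\matrix_(i, j) (((-1) ^+ p j) ^+ (N - i.+1) *:
                          'X_j ^+ (nth 0%N a j + (N - i.+1))))).
Proof.
move=> ha.
rewrite mulrCA.
have -> : \prod_(i < N) \prod_(j < N | (nth 0%N a j < nth 0%N a i)%N)
        ((xvar int i - cst N (-1 : int) * xvar int j) / (xvar int i - xvar int j)) =
   \prod_(i < N) \prod_(j < N | ~~ p j && p i)
      ((xvar int i + xvar int j) / (xvar int i - xvar int j)).
  apply: eq_bigr => i _; apply: eq_big => [j|j _].
    have := ha i; have := ha j; rewrite /p !inE; lia.
  by rewrite /cst mpolyCN mpolyC1 tofracN tofrac1 mulN1r opprK.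
rewrite det_rev_Vandermonde_signs; last exact: xvar_inj.
rewrite mulrCA -mul_mpolyC tofracM; congr (_ * _).
  rewrite !rmorph_prod; apply: eq_bigr => i _.
  rewrite !rmorph_prod; apply: eq_bigr => j _.
  by rewrite rmorphXn /= rmorphN1 rmorphXn /= rmorphN1.
rewrite -det_map_mx.
(* The monomial [x^a] is absorbed by scaling column [j] by [x_j^(a_j)]. *)
pose d := \row_(i < N) xvar int i ^+ nth 0%N a i.
have -> : \prod_(i < N) xvar int i ^+ nth 0%N a i = \det (diag_mx d).
  by rewrite det_diag; apply: eq_bigr => i _; rewrite mxE.
rewrite mulrC -det_mulmx; congr (\det _).
apply/matrixP => i j; rewrite mul_mx_diag !mxE.
rewrite exprMn exprD -mul_mpolyC !rmorphM /= !rmorphXn /= !rmorphN1.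
by rewrite -mulrA [in RHS]mulrCA mulrA mulrC.
Qed.

Lemma nth_two_parts (r M i : nat) :
  nth 0%N ([:: r; r] ++ nseq M 0%N) i = (if i < 2 then r else 0)%N.
Proof. by case: i => [|[|i]] //=; rewrite nth_nseq if_same. Qed.

(** There are [(M + 1) + M] pairs meeting the first two indices, an odd number. *)
Lemma prod_pair_signs_first_two M :
  \prod_(i < M.+2) \prod_(j < M.+2 | (i < j)%N)
     (-1) ^+ ((i < 2)%N || (j < 2)%N) = -1 :> int.
Proof.
rewrite 2!big_ord_recl [X in _ * (_ * X)]big1 => [|i _]; last first.
  rewrite big1 // => j ij; rewrite (_ : (_ || _) = false) ?expr0 //.
  by move: ij; rewrite /= /bump /=; lia.
rewrite mulr1 big_mkcond 2!big_ord_recl [X in _ * X]big_mkcond 2!big_ord_recl /=.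
rewrite !prodr_const !cardT size_enum_ord /= !mul1r.
by rewrite expr1 mulN1r mulNr -expr2 sqrr_sign.
Qed.

(** * The coefficient of [x^(la + delta)] on the Hall-Littlewood side *)

Section TwoOne.
Context (r l1 l2 m2 m1 M : nat).
Let la := [:: l1, l2 & nseq m2 2%N ++ nseq m1 1%N].
Let alpha := [multinom (nth 0%N la i + (M.+2 - i.+1))%N | i < M.+2].
Context (hM : M = (m2 + m1)%N).
Context (l12 : (l2 <= l1)%N) (hl2 : (2 <= l2)%N).
Context (hn : (l1 + l2 + 2 * m2 + m1 = 2 * r)%N).

(* Sends 0, 1 to m2, M+1 and is increasing on the other indices. *)
Let sigma : 'S_M.+2 := lift_perm ord0 (inord m2) (lift_perm ord0 ord_max 1).

Let sigma_val :
  [/\ sigma ord0 = m2 :> nat, sigma (lift ord0 ord0) = M.+1 :> nat &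
      forall k : 'I_M, sigma (lift ord0 (lift ord0 k)) = bump m2 k :> nat].
Proof.
have m2E : (inord m2 : 'I_M.+2) = m2 :> nat by rewrite inordK //; lia.
split; first by rewrite /sigma lift_perm_id.
  by rewrite /sigma lift_perm_lift lift_perm_id /= m2E /bump; lia.
move=> k; rewrite /sigma !lift_perm_lift perm1 /= m2E.
by congr bump; rewrite /bump leqNgt ltn_ord.
Qed.

Let exponent_eqP (s : 'S_M.+2) :
  reflect (s = sigma /\ r = (l2 + M)%N)
    [forall j : 'I_M.+2, nth 0%N ([:: r; r] ++ nseq M 0%N) j + (M.+2 - (s j).+1)
                         == alpha j]%N.
Proof.
have [s0 s1 sk] := sigma_val.
apply: (iffP forallP) => [H|[-> rE] j]; last first.
  rewrite mnmE nth_two_parts.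
  case: (unliftP ord0 j) => [{}j ->|->]; last by rewrite s0 /=; lia.
  case: (unliftP ord0 j) => [{}j ->|->]; last by rewrite s1 /= /bump /=; lia.
  rewrite sk; change (nth 0%N la _) with (nth 0%N (nseq m2 2%N ++ nseq m1 1%N) j).
  by rewrite nth_two_one -hM /= /bump; have := ltn_ord j; lia.
(* In column [k + 2] the exponents force [s] to lower the index by the corresponding part, which is
   2 for [k < m2] and 1 afterwards. *)
have Hk (k : 'I_M) : s (lift ord0 (lift ord0 k)) = bump m2 k :> nat.
  have := H (lift ord0 (lift ord0 k)); rewrite mnmE nth_two_parts.
  change (nth 0%N la _) with (nth 0%N (nseq m2 2%N ++ nseq m1 1%N) k).
  rewrite nth_two_one -hM; have := ltn_ord k; have := ltn_ord (s (lift ord0 (lift ord0 k))).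
  by rewrite /= /bump; lia.
have := H ord0; have := H (lift ord0 ord0); rewrite !mnmE !nth_two_parts /=.
have remaining (j : 'I_M.+2) : (j < 2)%N -> s j = m2 :> nat \/ s j = M.+1 :> nat.
  move=> j2; have [| sm2] := eqVneq (s j : nat) m2; first by left.
  have [| sM] := eqVneq (s j : nat) M.+1; first by right.
  have kM : (unbump m2 (s j) < M)%N.
    by have := ltn_ord (s j); rewrite /unbump; lia.
  have /val_inj/perm_inj/(congr1 val) : s (lift ord0 (lift ord0 (Ordinal kM))) = s j :> nat.
    by rewrite Hk /= unbumpK.
  by rewrite /= /bump /=; lia.
have := remaining ord0 isT; have := remaining (lift ord0 ord0) isT.
have s01 : s ord0 <> s (lift ord0 ord0) :> nat.
  by move/val_inj/perm_inj/(congr1 val).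
move=> R1 R0 H1 H0.
(* The opposite assignment would give [r = l1 + M + 1] and [r = l2 + m2 - 1], contradicting
   [l2 <= l1]. *)
have [E0 E1] : s ord0 = m2 :> nat /\ s (lift ord0 ord0) = M.+1 :> nat.
  by rewrite /bump /= in R0 R1 H0 H1 s01 *; lia.
split; last by rewrite /bump /= in H1 E1 *; lia.
apply/permP => j; apply: val_inj.
case: (unliftP ord0 j) => [{}j ->|->]; last by rewrite /= E0.
case: (unliftP ord0 j) => [{}j ->|->]; last by rewrite /= E1.
by rewrite /= Hk sk.
Qed.

Lemma mcoeff_det_signs_two_parts :
  (\det (\matrix_(i < M.+2, j < M.+2)
      (((-1) ^+ (j < 2)%N) ^+ (M.+2 - i.+1) *:
       'X_j ^+ (nth 0%N ([:: r; r] ++ nseq M 0%N) j + (M.+2 - i.+1))))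
     : {mpoly int[M.+2]})@_alpha = - (l1 == (l2 + m1)%N)%:R.
Proof.
rewrite mcoeff_det_scale_expX (bigD1 sigma) //= [X in _ + X]big1 => [|s ss]; last first.
  by case: exponent_eqP => [[/eqP]|]; rewrite ?(negPf ss) // mulr0.
rewrite addr0.
have -> : (l1 == l2 + m1)%N = (r == l2 + M)%N by lia.
have [s0 s1 sk] := sigma_val.
case: exponent_eqP => [[_ ->]|nE]; last first.
  by case: eqP => [rE|_]; [case: nE | rewrite mulr0 oppr0].
rewrite eqxx mulr1 2!big_ord_recl big1 ?mulr1 => [|i _]; last by rewrite expr1n.
rewrite s0 s1 subnn !expr0 mulr1 !odd_lift_perm odd_perm1 /= addbF.
rewrite inordK; last by lia.
rewrite expr1 -oddD signr_odd -exprD.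
(* The sign of [sigma] contributes [m2 + M] and the negated column 0 contributes [M + 1 - m2];
   column 1 has exponent 0 there. The total is odd. *)
have -> : (m2 + M + (M.+2 - m2.+1) = (2 * M).+1)%N by lia.
by rewrite exprS exprM sqrrN !expr1n.
Qed.

Lemma mcoeff_det_signs_other (a : seq nat) (c : 'I_M.+2 -> 'I_M.+2 -> int) :
  a \in permutations ([:: r; r] ++ nseq M 0%N) -> a != [:: r; r] ++ nseq M 0%N ->
  (\det (\matrix_(i < M.+2, j < M.+2)
      (c i j *: 'X_j ^+ (nth 0%N a j + (M.+2 - i.+1))))
     : {mpoly int[M.+2]})@_alpha = 0.
Proof.
rewrite mem_permutations => perm_a a_neq.
have [k ak0 k2] : exists2 k : 'I_M.+2, nth 0%N a k = 0%N & (k < 2)%N.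
  have := perm_size perm_a; rewrite /= size_nseq.
  case: a perm_a a_neq => [|x [|y t]] // perm_a a_neq _.
  have : x \in [:: r; r] ++ nseq M 0%N by rewrite -(perm_mem perm_a) inE eqxx.
  have : y \in [:: r; r] ++ nseq M 0%N by rewrite -(perm_mem perm_a) !inE eqxx orbT.
  rewrite !inE !mem_nseq !orbA !orbb.
  case/orP => [/eqP yr|/andP[_ /eqP y0]]; last by exists (lift ord0 ord0).
  (* If both leading entries equal [r], the others are all zero and [a] is the excluded
     arrangement. *)
  case/orP => [/eqP xr|/andP[_ /eqP x0]]; last by exists ord0.
  case/eqP: a_neq; move: perm_a; rewrite xr yr /= !perm_cons => perm_t.
  congr [:: r, r & _]; have /all_pred1P -> : all (pred1 0%N) t.
    by rewrite (perm_all _ perm_t) all_nseq /= orbT.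
  by rewrite (perm_size perm_t) size_nseq.
rewrite mcoeff_det_scale_expX big1 // => s _.
case: forallP => [/(_ k)|]; last by rewrite mulr0.
(* The exponent of [x_k] is at most [M + 1], whereas [alpha] requires at least [l2 + M >= M + 2]. *)
rewrite mnmE ak0; case: k k2 {ak0} => -[|[|k]] //= ? _; lia.
Qed.

End TwoOne.

(** * Comparison of the two expansions at [x^(la + delta)] *)

Theorem theorem4p8 (r l1 l2 m2 m1 : nat) (g : seq nat -> int)
  (n := (2 * r)%N)
  (la := [:: l1, l2 & nseq m2 2%N ++ nseq m1 1%N])
  (hr : (1 <= r)%N)
  (hla : is_partition la) (hn : sumn la = n) (hl2 : (2 <= l2)%N)
  (hg : hall_littlewood_schur_coeffs [:: r; r] g) :
  g la = \sum_(1 <= i < r)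
           (-1) ^+ (i + r + 1) *
           ((Nhook (n%:Z - i%:Z - l1%:Z) la)%:Z - (Nhook (i%:Z - l1%:Z) la)%:Z)
  /\
  g la = (if (l2 + m1 - 1 <= l1 <= l2 + m1 + 1)%N then 1 else 0).
Proof.
have l12 : (l2 <= l1)%N by case/andP: hla => /andP[].
have hn' : (l1 + l2 + 2 * m2 + m1 = 2 * r)%N.
  by move: hn; rewrite /n /= sumn_cat !sumn_nseq; lia.
suff gE : g la = (l1 == l2 + m1)%N%:Z.
  split; first by rewrite gE /la /n sum_Nhook_two_one.
  by rewrite gE; case: eqP; case: ifP; lia.
pose M := (m2 + m1)%N; pose N := M.+2.
have szla : size la = N by rewrite /= size_cat !size_nseq.
pose a0 := [:: r; r] ++ nseq M 0%N.
pose S a : int := \prod_(i < N) \prod_(j < N | (i < j)%N)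
  (-1) ^+ ((0 < nth 0 a i) || (0 < nth 0 a j))%N.
pose D a : {mpoly int[N]} := \det (\matrix_(i, j)
  (((-1) ^+ (0 < nth 0 a j)%N) ^+ (N - i.+1) *: 'X_j ^+ (nth 0%N a j + (N - i.+1)))).
pose A mu : {mpoly int[N]} :=
  \det (\matrix_(i < N, j < N) 'X_j ^+ (nth 0%N mu i + (N - i.+1))).
(* Multiplying the defining identity by [a_delta] clears all denominators, so that it becomes an
   identity of polynomials. *)
have E : \sum_(a <- permutations a0) S a *: D a =
    \sum_(mu <- partitions n) g mu *: (if (size mu <= N)%N then A mu else 0).
  apply/eqP; rewrite -tofrac_eq; apply/eqP.
  have := hg N; rewrite /hall_littlewood_P /=.
  have d0 := det_rev_Vandermonde_neq0 _ _ _ (@xvar_inj int N).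
  move/(congr1 ( *%R (\det (\matrix_(i < N, j < N) xvar int j ^+ (N - i.+1))))).
  rewrite !mulr_sumr !rmorph_sum /= => H.
  transitivity (\sum_(a <- permutations a0) tofrac (S a *: D a)) => //.
  rewrite (_ : n = (r + (r + 0))%N); last by rewrite /n; lia.
  rewrite [in RHS](eq_bigr (fun mu => \det (\matrix_(i < N, j < N) xvar int j ^+ (N - i.+1)) *
      (cst N (g mu) * schur int N mu))) => [|mu _].
    rewrite -H. have -> : (N - 2 = M)%N by rewrite /N; lia.
    apply: eq_big_seq => a; rewrite mem_permutations => perm_a.
    rewrite -(@alternant_hall_littlewood_term N r) // => i.
    have : nth 0%N a i \in a0.
      by rewrite -(perm_mem perm_a) mem_nth // (perm_size perm_a) /= size_nseq.
    by rewrite !inE mem_nseq; case/or3P => [/eqP->|/eqP->|/andP[_ /eqP->]];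
      rewrite eqxx ?orbT.
  rewrite /schur; case: leqP => szmu; last by rewrite scaler0 tofrac0 !mulr0.
  rewrite mulrCA [X in _ = _ * X]mulrC divfK // -mul_mpolyC tofracM; congr (_ * _).
  rewrite -det_map_mx; congr (\det _); apply/matrixP => i j.
  by rewrite !mxE rmorphXn.
have := congr1 (mcoeff [multinom (nth 0%N la i + (N - i.+1))%N | i < N]) E.
rewrite !raddf_sum (bigD1_seq a0) ?permutations_uniq ?mem_permutations //=.
rewrite [X in _ + X]big1_seq => [|a /andP[a_neq a_in]]; last first.
  by rewrite mcoeffZ (@mcoeff_det_signs_other r) ?mulr0.
rewrite addr0 mcoeffZ.
have -> : S a0 = -1.
  rewrite -[RHS](prod_pair_signs_first_two M); apply: eq_bigr => i _.
  apply: eq_bigr => j _; rewrite !nth_two_parts.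
  by congr ((-1) ^+ _); case: ifP; case: ifP; rewrite ?hr.
have -> : D a0 = \det (\matrix_(i < M.+2, j < M.+2)
      (((-1) ^+ (j < 2)%N) ^+ (M.+2 - i.+1) *:
       'X_j ^+ (nth 0%N ([:: r; r] ++ nseq M 0%N) j + (M.+2 - i.+1)))).
  congr (\det _); apply/matrixP => i j; rewrite !mxE; congr (_ ^+ _ *: _).
  by congr ((-1) ^+ _); rewrite nth_two_parts; case: ifP; rewrite ?hr.
(* The sign [S a0 = -1] cancels the sign of the surviving coefficient. *)
rewrite mcoeff_det_signs_two_parts // mulrNN mul1r natz => ->.
have la_in : la \in partitions n by rewrite mem_partitions hla hn eqxx.
clearbody la.
rewrite (bigD1_seq la) ?partitions_uniq //= [X in _ + X]big1_seq => [|mu].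
  by rewrite szla leqnn mcoeffZ mcoeff_alternant ?szla // eqxx mulr1 addr0.
rewrite mem_partitions => /andP[mu_neq /andP[pmu _]].
case: leqP => szmu; last by rewrite scaler0 mcoeff0.
by rewrite mcoeffZ mcoeff_alternant // (negPf mu_neq) mulr0.
Qed.
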